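(* Let $K$ be an algebraically closed field of characteristic not equal to $2$ and $3$. Let $(A,\circ)$ and $(E,\circ)$ be alternative algebras over $K$ such that $E$ contains $A$ as a subalgebra. Then there exist a subspace $V$ of $E$, an extending structure $\Omega(A,V)$ of $A$ by $V$, and an isomorphism of alternative algebras $(E,\circ)\cong A\natural V$ which stabilizes $A$ and co-stabilizes $V$.
   Context: An alternative algebra is a vector space $A$ with a bilinear multiplication $\circ$ such that, with $(x,y,z)=(x\circ y)\circ z-x\circ(y\circ z)$, one has $(x,y,z)=-(y,x,z)$ and $(x,y,z)=-(x,z,y)$ for all $x,y,z$. An extending datum of $A$ by $V$ is a system $\Omega(A,V)=(\triangleright,\triangleleft,\rightharpoonup,\leftharpoonup,*,\omega)$ of bilinear maps $\triangleright:A\times V\to V$, $\triangleleft:V\times A\to V$, $\rightharpoonup:V\times A\to A$, $\leftharpoonup:A\times V\to A$, $*:V\times V\to V$, $\omega:V\times V\to A$. $A\natural V$ denotes the vector space $A\oplus V$ with multiplication $$(x,u)\bullet(y,v)=\big(x\circ y+u\rightharpoonup y+x\leftharpoonup v+\omega(u,v),\ u*v+x\triangleright v+u\triangleleft y\big).$$ It is called the unified product, and $\Omega(A,V)$ an extending structure of $A$ by $V$, if this multiplication makes $A\oplus V$ an alternative algebra. Here $V$ is a linear complement of $A$ in $E$, $\pi:E=A\oplus V\to V$ is the projection along $A$, and $q:A\natural V\to V$ is the projection $(x,u)\mapsto u$. A linear map $\varphi:A\natural V\to E$ stabilizes $A$ if $\varphi(x,0)=x$ for all $x\in A$, and co-stabilizes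 $V$ if $\pi\circ\varphi=q$; an isomorphism $E\to A\natural V$ stabilizes $A$ (co-stabilizes $V$) if its inverse does. *)

(* Defs.v *)
From HB Require Import structures.
From mathcomp Require Import all_boot all_order all_algebra.

Set Implicit Arguments.
Unset Strict Implicit.
Unset Printing Implicit Defensive.

Import GRing.Theory.
Local Open Scope ring_scope.

(* The carrier of a linear subspace S of E, as an lmodType.  This plays the   *)
(* role of subvs_of, but E is not assumed finite dimensional.                 *)
Section Subspace.
Variables (K : fieldType) (E : lmodType K) (S : submodClosed E).

Inductive subsp : predArgType := Subsp u & u \in S.

Definition spval (w : subsp) : E := let: Subsp u _ := w in u.

HB.instance Definition _ := [isSub of subsp for spval].
HB.instance Definition _ := [Choice of subsp by <:].
HB.instance Definition _ := [SubChoice_isSubLmodule of subsp by <:].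

End Subspace.

Section Alternative.
Variables (K : fieldType) (A : lmodType K).

Definition associator (mul : A -> A -> A) (x y z : A) : A :=
  mul (mul x y) z - mul x (mul y z).

Definition alternative (mul : {bilinear A -> A -> A}) : Prop :=
  (forall x y z, associator mul x y z = - associator mul y x z) /\
  (forall x y z, associator mul x y z = - associator mul x z y).

End Alternative.

Section UnifiedProduct.
Variables (K : fieldType) (A V : lmodType K).

Record extending_datum : Type := ExtendingDatum {
  ed_rtri : {bilinear A -> V -> V};  (* \triangleright *)
  ed_ltri : {bilinear V -> A -> V};  (* \triangleleft *)
  ed_rharp : {bilinear V -> A -> A}; (* \rightharpoonup *)
  ed_lharp : {bilinear A -> V -> A}; (* \leftharpoonup *)
  ed_star : {bilinear V -> V -> V};
  ed_omega : {bilinear V -> V -> A}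
}.

Variables (mul : {bilinear A -> A -> A}) (W : extending_datum).

Definition unified_mul (p q : A * V) : A * V :=
  (mul p.1 q.1 + ed_rharp W p.2 q.1 + ed_lharp W p.1 q.2 + ed_omega W p.2 q.2,
   ed_star W p.2 q.2 + ed_rtri W p.1 q.2 + ed_ltri W p.2 q.1).

Fact unified_mul_bilinear : bilinear_for *:%R *:%R unified_mul.
Proof.
by split=> r a p q; rewrite /unified_mul; congr (_, _) => /=;
  rewrite ?linearPl ?linearPr /= !scalerDr; symmetry;
  do ?[rewrite addrACA; congr (_ + _)].
Qed.

HB.instance Definition _ :=
  bilinear_isBilinear.Build K (A * V)%type (A * V)%type (A * V)%type
    *:%R *:%R unified_mul unified_mul_bilinear.

Definition extending_structure : Prop := alternative unified_mul.

End UnifiedProduct.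

Section Complement.
Variables (K : fieldType) (E : lmodType K) (A V : submodClosed E).

Definition linear_complement : Prop :=
  (forall e : E, exists (a : subsp A) (v : subsp V), e = val a + val v) /\
  (forall e : E, e \in A -> e \in V -> e = 0).

Hypothesis AV : linear_complement.

Fact complement_proj_subproof (e : E) : exists v : subsp V, e - val v \in A.
Proof. by have [a [v ->]] := AV.1 e; exists v; rewrite addrK; apply: valP. Qed.

(* The projection E = A (+) V -> V along A: the unique v in V with e - v in A. *)
Definition complement_proj (e : E) : subsp V :=
  xchoose (complement_proj_subproof e).

Lemma complement_projE (a : subsp A) (v : subsp V) :
  complement_proj (val a + val v) = v.
Proof.
have /GRing.submod_closedB[_ AB] := submodClosedP A.
have /GRing.submod_closedB[_ VB] := submodClosedP V.
have := xchooseP (complement_proj_subproof (val a + val v)).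
rewrite -/(complement_proj _); set w := complement_proj _ => Aw.
apply/val_inj/esym/subr0_eq/AV.2; last exact: VB (valP v) (valP w).
by have := AB _ _ Aw (valP a); rewrite addrAC [val a + _]addrC addrK.
Qed.

End Complement.

(* The two conditions below are imposed on maps A \natural V -> E; an         *)
(* isomorphism E -> A \natural V satisfies them when its inverse does.        *)
Definition stabilizes (K : fieldType) (E : lmodType K) (A V : submodClosed E)
    (phi : subsp A * subsp V -> E) : Prop :=
  forall x : subsp A, phi (x, 0) = val x.

Definition costabilizes (K : fieldType) (E : lmodType K) (A V : submodClosed E)
    (AV : linear_complement A V) (phi : subsp A * subsp V -> E) : Prop :=
  forall p : subsp A * subsp V, complement_proj AV (phi p) = p.2.

Definition alg_iso (K : fieldType) (B C : lmodType K)
    (mulB : {bilinear B -> B -> B}) (mulC : {bilinear C -> C -> C})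
    (f : {linear B -> C}) (g : {linear C -> B}) : Prop :=
  [/\ cancel f g, cancel g f & {morph f : x y / mulB x y >-> mulC x y}].

(* Main.v *)
Require Import Defs.
From HB Require Import structures.
From mathcomp Require Import all_boot all_order all_algebra.
From mathcomp Require Import boolp classical_sets.

Set Implicit Arguments.
Unset Strict Implicit.
Unset Printing Implicit Defensive.

Import GRing.Theory.
Local Open Scope ring_scope.

(** The theorem is linear algebra followed by transport of structure. By Zorn's
lemma the subspace [A] has a complement [V] in [E], of arbitrary dimension
([exists_linear_complement]); write [pA] and [pV] for the two projections of
[E = A (+) V]. Then [(x, u) |-> x + u] is a linear bijection from [A * V] onto
[E], with inverse [e |-> (pA e, pV e)], and the multiplication of [E] pulls back
along it to some bilinear product on [A * V].

That product is a unified product: expanding [(x + u)(y + v)] by bilinearity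
and applying [pA] and [pV] to each of the four terms gives eight bilinear maps.
Two of them are forced, [pA (x y) = x y] and [pV (x y) = 0], because [A] is a
subalgebra; the other six are the extending datum ([complement_datum]).
Alternativity is stable under linear isomorphisms preserving the
multiplication ([alternative_alg_iso]), so this datum is an extending
structure. The bijection is the identity on [A] and commutes with the
projections to [V] by construction. *)

(** A maximal set [X] closed under linear combinations and meeting [A] only in 0
is a complement of [A]: were [e] outside [A + X], the set [X + K e] would be
larger with the same two properties. The empty set is allowed among the
candidates, so that the union of the empty chain is one. *)
Lemma exists_linear_complement (K : fieldType) (E : lmodType K)
    (A : submodClosed E) :
  exists V : submodClosed E, linear_complement A V.
Proof.
pose candidate (X : set E) :=
  (forall k u v, X u -> X v -> X (k *: u + v)) /\
  (forall e, e \in A -> X e -> e = 0).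
have [|X [[Xlin XA] Xmax]] := @Zorn_bigcup _ candidate.
  move=> F Fcand Ftot; split=> [k u v [X FX Xu] [Y FY Yv]|e Ae [X FX Xe]].
    have [XY|YX] := Ftot _ _ FX FY.
      by exists Y => //; apply: (Fcand _ FY).1 => //; apply: XY.
    by exists X => //; apply: (Fcand _ FX).1 => //; apply: YX.
  exact: (Fcand _ FX).2 Ae Xe.
have maxP Y : candidate Y -> (X `<=` Y)%classic -> (Y `<=` X)%classic.
  by move=> Ycand XY; apply: contrapT => YX; apply: (Xmax Y).
have X0 : X 0.
  have [[u Xu]|X_empty] := pselect (exists u, X u).
    by rewrite -(addNr u) -scaleN1r; apply: Xlin.
  suff /maxP : candidate [set 0]%classic.
    by apply=> // u Xu; case: X_empty; exists u.
  by split=> // k u v -> ->; rewrite scaler0 addr0.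
pose inX (e : E) : bool := `[< X e >].
have inX_closed : submod_closed inX.
  split=> [|k u v]; rewrite !unfold_in /inX !asboolE //; exact: Xlin.
pose V : submodClosed E :=
  HB.pack_for (submodClosed E) inX
    (GRing.isSubmodClosed.Build K E inX inX_closed).
have VP e : reflect (X e) (e \in V) by apply: asboolP.
exists V; split=> [e|e Ae /VP]; last exact: XA.
apply: contrapT => e_out.
have Xdecomp a x : a \in A -> X x -> e <> a + x.
  move=> Aa /VP Vx def_e; apply: e_out.
  by exists (Sub a Aa), (Sub x Vx); rewrite !SubK.
pose Y : set E := fun y => exists k x, X x /\ y = x + k *: e.
have XY : (X `<=` Y)%classic by move=> x Xx; exists 0, x; rewrite scale0r addr0.
have YX : (Y `<=` X)%classic.
  apply: maxP XY; split=> [k _ _ [k1 [x1 [Xx1 ->]]] [k2 [x2 [Xx2 ->]]]|y Ay].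
    exists (k * k1 + k2), (k *: x1 + x2); split; first exact: Xlin.
    by rewrite scalerDr scalerDl scalerA addrACA.
  case=> k [x [Xx def_y]]; have [k0|nz_k] := eqVneq k 0.
    by apply: XA Ay _; rewrite def_y k0 scale0r addr0.
  (* Dividing y = x + k e by k writes e as an element of A + X. *)
  case: (Xdecomp (k^-1 *: y) (- k^-1 *: x)); first exact: rpredZ.
    by rewrite -[_ *: x]addr0; apply: Xlin.
  by rewrite def_y scalerDr scalerA mulVf // scale1r scaleNr addrAC subrr add0r.
apply: (Xdecomp 0 e); rewrite ?rpred0 ?add0r //.
by apply: YX; exists 1, 0; rewrite scale1r add0r.
Qed.

Lemma linear_complementC (K : fieldType) (E : lmodType K)
    (A V : submodClosed E) : linear_complement A V -> linear_complement V A.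
Proof.
case=> AV A0V; split=> [e|e Ve Ae]; last exact: A0V.
by have [a [v ->]] := AV e; exists v, a; rewrite addrC.
Qed.

Lemma complement_proj_linear (K : fieldType) (E : lmodType K)
    (A V : submodClosed E) (AV : linear_complement A V) :
  linear (complement_proj AV).
Proof.
move=> k e f; have [a [v ->]] := AV.1 e; have [b [w ->]] := AV.1 f.
rewrite scalerDr addrACA -!linearP.
by rewrite !complement_projE.
Qed.

HB.instance Definition _ (K : fieldType) (E : lmodType K)
    (A V : submodClosed E) (AV : linear_complement A V) :=
  GRing.isLinear.Build K E (subsp V) *:%R (complement_proj AV)
    (complement_proj_linear AV).

Section Decomposition.
Variables (K : fieldType) (E : lmodType K) (A V : submodClosed E).
Hypothesis AV : linear_complement A V.

Local Notation pA := (complement_proj (linear_complementC AV)).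
Local Notation pV := (complement_proj AV).

Definition complement_sum (p : subsp A * subsp V) : E := val p.1 + val p.2.

Lemma complement_sum_linear : linear complement_sum.
Proof.
by move=> k p q; rewrite /complement_sum !linearP scalerDr addrACA.
Qed.

HB.instance Definition _ :=
  GRing.isLinear.Build K (subsp A * subsp V)%type E *:%R complement_sum
    complement_sum_linear.

Definition complement_split (e : E) : subsp A * subsp V := (pA e, pV e).

Lemma complement_split_linear : linear complement_split.
Proof. by move=> k e f; rewrite /complement_split !linearP. Qed.

HB.instance Definition _ :=
  GRing.isLinear.Build K E (subsp A * subsp V)%type *:%R complement_split
    complement_split_linear.

Lemma complement_sumK : cancel complement_sum complement_split.
Proof.
case=> a v; rewrite /complement_split /complement_sum complement_projE /=.
by rewrite addrC complement_projE.
Qed.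

Lemma complement_splitK : cancel complement_split complement_sum.
Proof.
move=> e; have [a [v ->]] := AV.1 e.
by rewrite -[val a + val v]/(complement_sum (a, v)) complement_sumK.
Qed.

Lemma complement_sum_inl (a : subsp A) : complement_sum (a, 0) = val a.
Proof. exact: addr0. Qed.

Lemma complement_split_val (a : subsp A) : complement_split (val a) = (a, 0).
Proof.
by rewrite -(complement_sumK (a, 0)) complement_sum_inl.
Qed.

End Decomposition.

Section CornerMul.
Variables (K : fieldType) (E U : lmodType K) (S T : submodClosed E).
Variables (mul : {bilinear E -> E -> E}) (p : {linear E -> U}).

Definition corner_mul (x : subsp S) (y : subsp T) : U := p (mul (val x) (val y)).

Lemma corner_mul_bilinear : bilinear_for *:%R *:%R corner_mul.
Proof.
by split=> x k y z; rewrite /corner_mul linearP /= ?linearPl ?linearPr linearP.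
Qed.

HB.instance Definition _ :=
  bilinear_isBilinear.Build K (subsp S) (subsp T) U *:%R *:%R corner_mul
    corner_mul_bilinear.

End CornerMul.

Definition complement_datum (K : fieldType) (E : lmodType K)
    (mul : {bilinear E -> E -> E}) (A V : submodClosed E)
    (AV : linear_complement A V) : extending_datum (subsp A) (subsp V) :=
  let pA := complement_proj (linear_complementC AV) in
  let pV := complement_proj AV in
  {| ed_rtri := corner_mul mul pV; ed_ltri := corner_mul mul pV;
     ed_rharp := corner_mul mul pA; ed_lharp := corner_mul mul pA;
     ed_star := corner_mul mul pV; ed_omega := corner_mul mul pA |}.

(** Bilinearity splits a product in [E] into four terms. The one with both
factors in [A] stays in [A], so its two components are [mulA x y] and 0; the
other three produce the six maps of the datum. *)
Lemma complement_split_mul (K : fieldType) (E : lmodType K)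
    (mul : {bilinear E -> E -> E}) (A V : submodClosed E)
    (AV : linear_complement A V)
    (mulA : {bilinear subsp A -> subsp A -> subsp A}) :
    (forall x y, val (mulA x y) = mul (val x) (val y)) ->
  {morph complement_split AV : e f / mul e f >->
     unified_mul mulA (complement_datum mul AV) e f}.
Proof.
move=> subA e f; rewrite -{1}(complement_splitK AV e).
rewrite -{1}(complement_splitK AV f).
case: (complement_split AV e) (complement_split AV f) => [x u] [y v].
rewrite /complement_sum linearDl !linearDr /= -subA !linearD /=.
rewrite complement_split_val /unified_mul /complement_split /=.
rewrite /corner_mul; congr (_, _) => /=.
  by rewrite addrA; congr (_ + _); rewrite addrAC.
by rewrite add0r addrA addrC addrA.
Qed.

(** The associator of the target is the image under [f] of the associator of
the source, and [f] is additive. *)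
Lemma alternative_alg_iso (K : fieldType) (B C : lmodType K)
    (mulB : {bilinear B -> B -> B}) (mulC : {bilinear C -> C -> C})
    (f : {linear B -> C}) (g : {linear C -> B}) :
  alg_iso mulB mulC f g -> alternative mulB -> alternative mulC.
Proof.
case=> _ gK fM [altl altr].
have associatorE x y z : associator mulC x y z =
    f (associator mulB (g x) (g y) (g z)).
  by rewrite /associator linearB /= !fM !gK.
split=> x y z; rewrite !associatorE -linearN; congr (f _).
  exact: altl.
exact: altr.
Qed.

Theorem theorem3p4 (K : closedFieldType)
    (charK2 : 2%N \notin [pchar K]) (charK3 : 3%N \notin [pchar K])
    (E : lmodType K) (mulE : {bilinear E -> E -> E}) (altE : alternative mulE)
    (A : submodClosed E) (mulA : {bilinear subsp A -> subsp A -> subsp A})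
    (altA : alternative mulA)
    (subA : forall x y : subsp A, val (mulA x y) = mulE (val x) (val y)) :
  exists (V : submodClosed E) (AV : linear_complement A V)
         (W : extending_datum (subsp A) (subsp V)),
    extending_structure mulA W /\
    exists (psi : {linear E -> (subsp A * subsp V)%type})
           (phi : {linear (subsp A * subsp V)%type -> E}),
      [/\ alg_iso mulE (unified_mul mulA W) psi phi,
          stabilizes phi & costabilizes AV phi].
Proof.
have [V AV] := exists_linear_complement A.
pose W := complement_datum mulE AV.
have iso : alg_iso mulE (unified_mul mulA W)
    (complement_split AV) (@complement_sum K E A V).
  split; [exact: complement_splitK | exact: complement_sumK |].
  exact: complement_split_mul.
exists V, AV, W; split; first exact: alternative_alg_iso iso altE.
exists (complement_split AV), (@complement_sum K E A V); split=> //.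
  exact: complement_sum_inl.
by move=> p; rewrite /complement_sum complement_projE.
Qed.
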